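(* For any integer $n\ge 0$, there exists a simplicial set $X$ such that $\mathrm{Ex}^n(X)$ does not satisfy the Kan extension condition (i.e. is not a Kan complex), but $\mathrm{Ex}^{n+1}(X)$ does.
   Context: Let $\mathit{SSet}$ be the category of simplicial sets and $\Delta_k$ the standard $k$-simplex. $\mathrm{Sd}:\mathit{SSet}\to\mathit{SSet}$ is the simplicial subdivision functor: the colimit-preserving functor with $\mathrm{Sd}(\Delta_k)$ equal to the nerve of the poset of non-empty subsets of $\{0,1,\dots,k\}$ ordered by inclusion (functorially in $k$, by taking direct images). $\mathrm{Ex}$ is Kan's extension functor, the right adjoint of $\mathrm{Sd}$, so $\mathrm{Ex}(X)_k=\mathrm{Hom}_{\mathit{SSet}}(\mathrm{Sd}(\Delta_k),X)$. $\mathrm{Ex}^n$ denotes the $n$-fold iterate of $\mathrm{Ex}$, with $\mathrm{Ex}^0=\mathrm{id}$. A simplicial set satisfies the Kan extension condition (is a Kan complex) if every map to it from a horn $\Lambda^i_k$, $k\ge1$, $0\le i\le k$, extends along $\Lambda^i_k\hookrightarrow\Delta_k$. *)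

(* Defs.v *)
From Stdlib Require Import FunctionalExtensionality ProofIrrelevance.
From HB Require Import structures.
From mathcomp Require Import all_boot all_order.

Set Implicit Arguments.
Unset Strict Implicit.
Unset Printing Implicit Defensive.

Import Order.Theory Order.DefaultSetSubsetOrder.
Local Open Scope order_scope.

(** * Monotone maps out of a finite poset

    The ordinal [n] = {0 < ... < n} is ['I_n.+1] with its canonical order.
    Monotone maps are a subtype of finite functions, so that extensionally
    equal maps are equal. *)

Section Monotone.
Variables (d d' : Order.disp_t) (T : finPOrderType d) (P : porderType d').

Definition monotoneb (f : {ffun T -> P}) : bool :=
  [forall x, forall y, (x <= y) ==> (f x <= f y)].

Definition mono : Type := {f : {ffun T -> P} | monotoneb f}.

Definition mono_fun (f : mono) : T -> P := val f.

Coercion mono_fun : mono >-> Funclass.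

Lemma monotoneP (f : {ffun T -> P}) :
  reflect (forall x y, x <= y -> f x <= f y) (monotoneb f).
Proof.
apply: (iffP forallP) => [h x y|h x]; first by have /forallP/(_ y)/implyP := h x.
by apply/forallP => y; apply/implyP; apply: h.
Qed.

Lemma mono_le (f : mono) x y : x <= y -> f x <= f y.
Proof. exact: (monotoneP _ (valP f)). Qed.

Lemma mk_mono_subproof (g : T -> P) :
  (forall x y, x <= y -> g x <= g y) -> monotoneb [ffun x => g x].
Proof. by move=> h; apply/monotoneP => x y le_xy; rewrite !ffunE; apply: h. Qed.

Definition mk_mono (g : T -> P) (h : forall x y, x <= y -> g x <= g y) : mono :=
  exist _ [ffun x => g x] (mk_mono_subproof h).

Lemma mk_monoE (g : T -> P) (h : forall x y, x <= y -> g x <= g y) x :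
  mk_mono h x = g x.
Proof. by rewrite /mono_fun /= ffunE. Qed.

Lemma mono_ext (f g : mono) : f =1 g -> f = g.
Proof. by move=> e; apply/val_inj/ffunP. Qed.

End Monotone.

Definition mono_id d (T : finPOrderType d) : mono T T :=
  mk_mono (g := fun x => x) (fun x y le_xy => le_xy).

Definition mono_comp d1 d2 d3 (T : finPOrderType d1) (P : finPOrderType d2)
    (Q : porderType d3) (g : mono P Q) (f : mono T P) : mono T Q :=
  mk_mono (g := fun x => g (f x)) (fun x y le_xy => mono_le g (mono_le f le_xy)).

Lemma mono_idE d (T : finPOrderType d) x : mono_id T x = x.
Proof. exact: mk_monoE. Qed.

Lemma mono_compE d1 d2 d3 (T : finPOrderType d1) (P : finPOrderType d2)
    (Q : porderType d3) (g : mono P Q) (f : mono T P) x :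
  mono_comp g f x = g (f x).
Proof. exact: mk_monoE. Qed.

(** * Simplicial sets *)

(* [dmap m n] is the set of morphisms [m] -> [n] of the simplex category. *)
Notation dmap m n := (mono 'I_m.+1 'I_n.+1).

Record sset : Type := SSet {
  simplex :> nat -> Type;
  act : forall m n, dmap m n -> simplex n -> simplex m;
  act_id : forall n (x : simplex n), act (mono_id _) x = x;
  act_comp : forall l m n (g : dmap m n) (f : dmap l m) (x : simplex n),
    act (mono_comp g f) x = act f (act g x) }.

Arguments act X [m n] _ _ : rename.

Record hom (X Y : sset) : Type := Hom {
  hom_fun :> forall n, X n -> Y n;
  hom_nat : forall m n (f : dmap m n) (x : X n),
    hom_fun (act X f x) = act Y f (hom_fun x) }.

Arguments hom_fun {X Y} h [n] x : rename.

Lemma hom_ext (X Y : sset) (f g : hom X Y) :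
  (forall n (x : X n), f n x = g n x) -> f = g.
Proof.
case: f g => [f hf] [g hg] /= e.
have efg : f = g.
  by apply: functional_extensionality_dep => n; apply: functional_extensionality.
by case: _ / efg hg => hg; rewrite (proof_irrelevance _ hf hg).
Qed.

Definition hom_comp (X Y Z : sset) (g : hom Y Z) (f : hom X Y) : hom X Z.
Proof.
by exists (fun n x => g n (f n x)) => m n h x; rewrite !hom_nat.
Defined.

(** * Nerves and standard simplices *)

Section Nerve.
Variables (d : Order.disp_t) (P : porderType d).

Definition nerve : sset.
Proof.
exists (fun n => mono 'I_n.+1 P) (fun m n f x => mono_comp x f).
- by move=> n x; apply: mono_ext => i; rewrite mono_compE mono_idE.
- by move=> l m n g f x; apply: mono_ext => i; rewrite !mono_compE.
Defined.

End Nerve.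

Definition nerve_map d d' (P : finPOrderType d) (Q : porderType d')
  (f : mono P Q) : hom (nerve P) (nerve Q).
Proof.
exists (fun n (x : nerve P n) => mono_comp f x : nerve Q n).
by move=> m n g x; apply: mono_ext => i; rewrite /= !mono_compE.
Defined.

Definition Delta (k : nat) : sset := nerve 'I_k.+1.

(** * Subdivided simplices and Kan's functor Ex

    The n-fold iterate of Ex is [iter n Ex]. *)

Record nesubset (T : finType) : Type :=
  NESubset { nes_set :> {set T}; nes_neq0 : nes_set != set0 }.

HB.instance Definition _ (T : finType) := [isSub for @nes_set T].
HB.instance Definition _ (T : finType) := [Finite of nesubset T by <:].
HB.instance Definition _ (T : finType) :=
  [SubChoice_isSubPOrder of nesubset T by <:
     with Order.SetSubsetOrder.subset_display].

Lemma nesubset_leE (T : finType) (A B : nesubset T) :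
  (A <= B) = (A \subset B).
Proof. by []. Qed.

Section DirectImage.
Variables (T U : finType) (f : T -> U).

Lemma direct_image_subproof (A : nesubset T) : f @: A != set0.
Proof. by rewrite imset_eq0 nes_neq0. Qed.

Definition direct_image (A : nesubset T) : nesubset U :=
  NESubset (direct_image_subproof A).

Lemma direct_image_le (A B : nesubset T) :
  A <= B -> direct_image A <= direct_image B.
Proof. by rewrite !nesubset_leE; apply: imsetS. Qed.

End DirectImage.

Definition SdDelta (k : nat) : sset := nerve (nesubset 'I_k.+1).

Definition SdDelta_map (m n : nat) (f : dmap m n) : hom (SdDelta m) (SdDelta n) :=
  nerve_map (mk_mono (@direct_image_le _ _ f)).

Definition Ex (X : sset) : sset.
Proof.
exists (fun k => hom (SdDelta k) X)
       (fun m n f (x : hom (SdDelta n) X) => hom_comp x (SdDelta_map f)).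
- move=> n x; apply: hom_ext => m s /=; congr (x m _).
  apply: mono_ext => i; rewrite mono_compE mk_monoE; apply: val_inj => /=.
  by rewrite -[RHS]imset_id; apply: eq_imset => j; rewrite mono_idE.
- move=> l m n g f x; apply: hom_ext => p s /=; congr (x p _).
  apply: mono_ext => i; rewrite !mono_compE !mk_monoE; apply: val_inj => /=.
  by rewrite -imset_comp; apply: eq_imset => j; rewrite mono_compE.
Defined.

(** * Horns and the Kan extension condition *)

(* A simplex of Delta k lies in the horn iff its image misses some vertex
   j != i, that is, iff it lies on some face opposite to a vertex j != i. *)
Definition in_horn (k : nat) (i : 'I_k.+1) (m : nat) (s : dmap m k) : bool :=
  [exists j, (j != i) && [forall x, s x != j]].

Lemma in_horn_act (k : nat) (i : 'I_k.+1) (m n : nat) (f : dmap m n)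
    (s : dmap n k) :
  in_horn i s -> in_horn i (mono_comp s f).
Proof.
case/existsP=> j /andP[ji /forallP h]; apply/existsP; exists j.
by rewrite ji; apply/forallP => x; rewrite mono_compE.
Qed.

Definition horn (k : nat) (i : 'I_k.+1) : sset.
Proof.
exists (fun m => {s : Delta k m | in_horn i s})
       (fun m n f s => exist _ (act (Delta k) f (val s)) (in_horn_act f (valP s))).
- by move=> n s; apply/val_inj/(act_id (s := Delta k)).
- by move=> l m n g f s; apply/val_inj/(act_comp (s := Delta k)).
Defined.

Definition horn_incl (k : nat) (i : 'I_k.+1) : hom (horn i) (Delta k) :=
  @Hom (horn i) (Delta k) (fun m s => val s) (fun m n f s => erefl).

Definition is_kan (X : sset) : Prop :=
  forall (k : nat) (i : 'I_k.+1), (1 <= k)%N ->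
  forall h : hom (horn i) X,
  exists g : hom (Delta k) X, hom_comp g (horn_incl i) = h.

(* Main.v *)
(** Let X be the flag complex of the path 0 - 1 - ... - L with L = 2^n + 1. An edge
    of Ex^n X is a zigzag of 2^n edges of X, so it cannot join 0 to L; but unit
    edges do exist in Ex^n X, and in a Kan complex they would compose to an edge
    from 0 to L. Hence Ex^n X is not Kan.

    A horn in Ex^(n+1) X is a 1-Lipschitz map f with values in [0, L] on the vertices
    of Sd^(n+1) of the horn. A discrete distance h to the subdivided horn and a
    retraction r of its collar {2 h <= 2^n} onto it are available: subdividing
    doubles h, and at the first subdivision the collar is the horn itself.
    Clamping f o r to [h, L - h] extends f to the collar, and at its boundary
    only the middle values of [0, L] remain, so a constant extends it further. *)

Require Import Defs.
From mathcomp Require Import all_boot all_order zify.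

Set Implicit Arguments.
Unset Strict Implicit.
Unset Printing Implicit Defensive.

Import Order.Theory Order.DefaultSetSubsetOrder.

(** * Partial maps out of the nerve of a finite poset *)

Section Constant.
Variables (d d' : Order.disp_t) (T : finPOrderType d).

Definition cst (P : porderType d') (x : P) : mono T P :=
  mk_mono (g := fun=> x) (fun _ _ _ => lexx x).

Lemma cstE (P : porderType d') (x : P) y : cst x y = x.
Proof. exact: mk_monoE. Qed.

End Constant.

Arguments cst {d d' T P} x.

Section PartialHom.
Variables (d : Order.disp_t) (P : finPOrderType d).
Implicit Types (D : pred {set P}) (X : sset).

Definition simage m (s : mono 'I_m.+1 P) : {set P} := [set s x | x : 'I_m.+1].

Lemma simageP m (s : mono 'I_m.+1 P) x : s x \in simage s.
Proof. exact: imset_f. Qed.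

Lemma simage_sub m (s : mono 'I_m.+1 P) (A : {set P}) :
  (forall x, s x \in A) -> simage s \subset A.
Proof. by move=> h; apply/subsetP => _ /imsetP[x _ ->]. Qed.

(* Maps to X from the subcomplex of the nerve of P spanned by the simplices with
   vertex set in D. *)
Record phom D X : Type := PHom {
  phom_fun :> forall m (s : mono 'I_m.+1 P), D (simage s) -> X m;
  phom_nat : forall l m (f : dmap l m) (s : mono 'I_m.+1 P)
    (hs : D (simage s)) (hsf : D (simage (mono_comp s f))),
    phom_fun hsf = act X f (phom_fun hs) }.

Lemma phomE D X (phi : phom D X) l m (f : dmap l m) (s : mono 'I_m.+1 P)
    (s' : mono 'I_l.+1 P) (hs : D (simage s)) (hs' : D (simage s')) :
  (forall x, s' x = s (f x)) -> phi _ _ hs' = act X f (phi _ _ hs).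
Proof.
move=> e; have es : s' = mono_comp s f.
  by apply: mono_ext => x; rewrite mono_compE.
by case: _ / (esym es) hs' => hs'; apply: phom_nat.
Qed.

Lemma phom_eq D X (phi : phom D X) m (s s' : mono 'I_m.+1 P)
    (hs : D (simage s)) (hs' : D (simage s')) :
  s =1 s' -> phi _ _ hs = phi _ _ hs'.
Proof.
by move=> /mono_ext e; case: _ / e hs' => hs'; rewrite (bool_irrelevance hs hs').
Qed.

Definition extends D1 D2 X : Prop :=
  forall phi : phom D1 X, exists psi : phom D2 X,
  forall m (s : mono 'I_m.+1 P) (h1 : D1 (simage s)) (h2 : D2 (simage s)),
    psi _ _ h2 = phi _ _ h1.

Definition chain (A : {set P}) : bool :=
  [forall x in A, forall y in A, (x >=< y)%O].

Lemma chainP (A : {set P}) :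
  reflect {in A &, forall x y, (x >=< y)%O} (chain A).
Proof.
apply: (iffP forall_inP) => [h x y xA yA|h x xA].
  by have /forall_inP := h x xA; apply.
by apply/forall_inP => y yA; apply: h.
Qed.

Lemma sub_chain (A B : {set P}) : A \subset B -> chain B -> chain A.
Proof.
by move=> /subsetP AB /chainP h; apply/chainP => x y /AB xB /AB yB; apply: h.
Qed.

Lemma simage_chain m (s : mono 'I_m.+1 P) : chain (simage s).
Proof.
apply/chainP => _ _ /imsetP[x _ ->] /imsetP[y _ ->].
by case/orP: (le_total x y) => /(mono_le s) le_s;
  rewrite /Order.comparable le_s ?orbT.
Qed.

(** These are the nondegenerate simplices of the subcomplex [D]; the nerve of this poset is the
    subdivision of the subcomplex. *)
Definition chains D : {set nesubset P} := [set A : nesubset P | D A && chain A].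

(** Full subcomplexes: one subdivision turns any subcomplex into one of these. *)
Definition within (Q : {set P}) : pred {set P} := fun A => A \subset Q.

Definition down_closed D := forall A B : {set P}, A \subset B -> D B -> D A.

Lemma within_down (Q : {set P}) : down_closed (within Q).
Proof. by move=> A B; apply: subset_trans. Qed.

Lemma withinP (Q : {set P}) m (s : mono 'I_m.+1 P) :
  reflect (forall x, s x \in Q) (within Q (simage s)).
Proof.
apply: (iffP idP) => [/subsetP h x|]; last exact: simage_sub.
exact/h/simageP.
Qed.

End PartialHom.


(** * Subdivision and Ex as adjoints, for subcomplexes of nerves *)

Section Transfer.
Variables (d : Order.disp_t) (P : finPOrderType d).

(* Chains have no canonical enumeration by a simplex of the right dimension.
   Instead every chain c is covered by one fixed simplex of dimension #|P|, via
   the retraction [chain_floor] of the section [rank] of c. *)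
Definition rank_fun (p : P) : 'I_#|P|.+1 := inord #|[set q | (q < p)%O]|.

Lemma rank_ltE (p : P) : (rank_fun p : nat) = #|[set q | (q < p)%O]|.
Proof. by rewrite inordK // ltnS max_card. Qed.

Lemma rank_lt (p q : P) : (p < q)%O -> rank_fun p < rank_fun q.
Proof.
move=> pq; rewrite !rank_ltE; apply: proper_card; apply/properP; split.
  by apply/subsetP => r; rewrite !inE => /lt_trans; apply.
by exists p; rewrite !inE ?ltxx.
Qed.

Lemma rank_le (p q : P) : (p <= q)%O -> (rank_fun p <= rank_fun q)%O.
Proof.
by rewrite le_eqVlt => /predU1P[-> //|/rank_lt/ltnW].
Qed.

Definition rank : mono P 'I_#|P|.+1 := mk_mono rank_le.

Lemma rank_chain_le (c : {set P}) p q : chain c -> p \in c -> q \in c ->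
  (rank p <= rank q)%N = (p <= q)%O.
Proof.
move=> /chainP hc pc qc; rewrite !mk_monoE; apply/idP/idP => [|/rank_le //].
move=> pq; apply: contraT; rewrite -comparable_ltNge ?hc // => /rank_lt.
by rewrite ltnNge pq.
Qed.

Definition chain_bot (c : nesubset P) : P :=
  [arg min_(p < xchoose (set0Pn _ (nes_neq0 c)) in c) (rank p : nat)].

(** If no element of [c] has rank at most [x], the arg max returns its default, the least element of
    [c], which keeps the map monotone. *)
Definition chain_floor_fun (c : nesubset P) (x : 'I_#|P|.+1) : P :=
  [arg max_(p > chain_bot c | (p \in nes_set c) && (rank p <= x)%N) (rank p : nat)].

Lemma chain_botP (c : nesubset P) :
  chain_bot c \in nes_set c /\ forall p, p \in nes_set c -> (rank (chain_bot c) <= rank p)%N.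
Proof.
rewrite /chain_bot; case: arg_minnP; last by move=> p.
exact: (xchooseP (set0Pn _ (nes_neq0 c))).
Qed.

Lemma chain_floorP (c : nesubset P) x :
  chain_floor_fun c x \in nes_set c /\
  forall p, p \in nes_set c -> (rank p <= x)%N ->
    (rank p <= rank (chain_floor_fun c x) <= x)%N.
Proof.
have [bc bP] := chain_botP c.
have [bx|xb] := leqP (rank (chain_bot c)) x.
  rewrite /chain_floor_fun; case: arg_maxnP; first by rewrite bc.
  move=> p /andP[pc px] pP; split=> // q qc qx.
  by rewrite px andbT; apply: pP; rewrite qc.
have nP p : p \in nes_set c -> (rank p <= x)%N -> False.
  by move=> /bP bp /(leq_trans bp); rewrite leqNgt xb.
split; last by move=> p /nP h /h.
rewrite /chain_floor_fun /arg_max /extremum; case: pickP => [p|//].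
by case/andP=> /andP[pc].
Qed.

Lemma chain_floor_mono (c : nesubset P) : chain c ->
  forall x y, (x <= y)%O -> (chain_floor_fun c x <= chain_floor_fun c y)%O.
Proof.
move=> hc x y xy; have [xc xP] := chain_floorP c x; have [yc yP] := chain_floorP c y.
rewrite -(rank_chain_le hc) //.
have [/existsP[p /andP[pc px]]|] := boolP [exists p in nes_set c, (rank p <= x)%N].
  have /andP[_ h] := xP p pc px.
  by have /andP[] := yP _ xc (leq_trans h xy).
rewrite negb_exists_in => /forall_inP h.
suff -> : chain_floor_fun c x = chain_bot c by exact: (chain_botP c).2.
rewrite /chain_floor_fun /arg_max /extremum; case: pickP => [p|//].
by case/andP=> /andP[/h /negbTE ->].
Qed.

Definition chain_floor (c : nesubset P) (hc : chain c) : mono 'I_#|P|.+1 P :=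
  mk_mono (chain_floor_mono hc).

Lemma chain_floor_in (c : nesubset P) (hc : chain c) x :
  chain_floor hc x \in nes_set c.
Proof. by rewrite mk_monoE; case: (chain_floorP c x). Qed.

Lemma chain_floor_rank (c : nesubset P) (hc : chain c) p :
  p \in nes_set c -> chain_floor hc (rank p) = p.
Proof.
move=> pc; rewrite mk_monoE; have [fc /(_ p pc (leqnn _)) /andP[h1 h2]] := chain_floorP c (rank p).
by apply/le_anti; rewrite -!(rank_chain_le hc) // h1 h2.
Qed.

Definition image_mono d1 d2 (T : finPOrderType d1) (U : finPOrderType d2)
  (f : mono T U) : mono (nesubset T) (nesubset U) :=
  mk_mono (@direct_image_le T U f).

Lemma image_monoE d1 d2 (T : finPOrderType d1) (U : finPOrderType d2)
  (f : mono T U) A : image_mono f A = f @: A :> {set U}.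
Proof. by rewrite mk_monoE. Qed.

Variables (D1 D2 : pred {set P}) (X : sset).
Hypotheses (D1_down : down_closed D1) (D2_down : down_closed D2).

Section Transpose.
Variable phi : phom D1 (Ex X).

Lemma floor_domain (c : nesubset P) (hc : chain c) : D1 c -> D1 (simage (chain_floor hc)).
Proof. by apply: D1_down; apply: simage_sub => x; apply: chain_floor_in. Qed.

Definition transpose_fun (c : nesubset P) (hc : chain c) (Dc : D1 c) :
  hom (SdDelta #|P|) X := phi _ _ (floor_domain hc Dc).

(** A simplex [x] inside [c] is the composite of [x], [rank] and [chain_floor], so naturality reads
    off its image from the simplex that covers [c]. *)
Lemma phi_transpose s (x : mono 'I_s.+1 P) (hx : D1 (simage x))
    (c : nesubset P) (hc : chain c) (Dc : D1 c) m
    (t : mono 'I_m.+1 (nesubset 'I_s.+1)) (t' : mono 'I_m.+1 (nesubset P)) :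
  simage x \subset nes_set c -> (forall i, t' i = x @: t i :> {set P}) ->
  (phi _ _ hx : hom (SdDelta s) X) m t =
  transpose_fun hc Dc _ (mono_comp (image_mono rank) t' : SdDelta _ _).
Proof.
move=> xc tt'; rewrite /transpose_fun.
rewrite (@phomE _ _ _ _ phi _ _ (mono_comp rank x) _ _ (floor_domain hc Dc) hx) /=.
  congr (hom_fun _ _); apply: mono_ext => i; apply: val_inj.
  rewrite /= !mono_compE !image_monoE tt' -imset_comp.
  by apply: eq_imset => j; rewrite /= mono_compE.
by move=> i; rewrite mono_compE chain_floor_rank //; apply: (subsetP xc); apply: simageP.
Qed.

(** This gives the naturality of [transpose]: a face of a simplex of chains may have a smaller top
    chain, and both tops must give the same value. *)
Lemma transpose_indep (c c' : nesubset P) (hc : chain c) (hc' : chain c')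
    (Dc : D1 c) (Dc' : D1 c') m (t : mono 'I_m.+1 (nesubset P)) :
  (c' <= c)%O -> (forall i, (t i <= c')%O) ->
  transpose_fun hc' Dc' _ (mono_comp (image_mono rank) t : SdDelta _ _) =
  transpose_fun hc Dc _ (mono_comp (image_mono rank) t : SdDelta _ _).
Proof.
move=> cc' tc'; apply: phi_transpose.
  apply: simage_sub => x; apply: (subsetP cc'); exact: chain_floor_in.
move=> i; rewrite mono_compE image_monoE -imset_comp -[LHS]imset_id.
apply: eq_in_imset => p pt; rewrite /= chain_floor_rank //.
exact: (subsetP (tc' i)).
Qed.

Lemma le_top m (t : mono 'I_m.+1 (nesubset P)) i : (t i <= t ord_max)%O.
Proof. by apply: mono_le; apply: leq_ord. Qed.

Lemma top_chains m (t : mono 'I_m.+1 (nesubset P)) :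
  within (chains D1) (simage t) -> chain (t ord_max) /\ D1 (t ord_max).
Proof. by move/withinP/(_ ord_max); rewrite inE => /andP[]. Qed.

(* The maps from the nerve of a poset to [Ex X] are the maps from the nerve of
   its poset of chains to X. *)
Definition transpose : phom (within (chains D1)) X.
Proof.
exists (fun m t ht => transpose_fun (top_chains ht).1 (top_chains ht).2 _
  (mono_comp (image_mono rank) t : SdDelta _ _)).
move=> l m f t ht htf.
rewrite (transpose_indep (top_chains ht).1 _ (top_chains ht).2) //.
- rewrite -hom_nat; congr (hom_fun _ _); apply: mono_ext => i.
  by rewrite /= !mono_compE.
- by rewrite mono_compE; apply: le_top.
- exact: le_top.
Defined.

End Transpose.

Lemma image_within D (D_down : down_closed D) s (x : mono 'I_s.+1 P) m
    (t : mono 'I_m.+1 (nesubset 'I_s.+1)) :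
  D (simage x) -> within (chains D) (simage (mono_comp (image_mono x) t)).
Proof.
move=> hx; apply/withinP => i; rewrite inE mono_compE image_monoE.
have sub : x @: t i \subset simage x by apply: imsetS; apply/subsetP.
by rewrite (D_down _ _ sub hx) (sub_chain sub) // simage_chain.
Qed.

Section Untranspose.
Variable psi : phom (within (chains D2)) X.

Definition untranspose_fun s (x : mono 'I_s.+1 P) (hx : D2 (simage x)) : hom (SdDelta s) X.
Proof.
exists (fun m (t : SdDelta s m) => psi _ _ (image_within D2_down t hx)).
by move=> l m f t; apply: phomE => i; rewrite !mono_compE.
Defined.

Definition untranspose : phom D2 (Ex X).
Proof.
exists (fun s (x : mono 'I_s.+1 P) hx => untranspose_fun hx : Ex X s).
move=> l m f x hx hxf; apply: hom_ext => s t /=.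
apply: phom_eq => i; rewrite !mono_compE; apply: val_inj.
rewrite /= !image_monoE -imset_comp.
by apply: eq_imset => j; rewrite /= mono_compE.
Defined.

End Untranspose.

(** Transpose, extend over the subdivision, transpose back. On a simplex [x] of [D1] the round trip
    is the identity, seen by comparing both sides on the chain [simage x]. *)
Lemma extends_Ex :
  extends (within (chains D1)) (within (chains D2)) X -> extends D1 D2 (Ex X).
Proof.
move=> ext phi; have [psi psiE] := ext (transpose phi).
exists (untranspose psi) => s x h1 h2; apply: hom_ext => m t /=.
have ne : simage x != set0 by apply/set0Pn; exists (x ord0); apply: simageP.
pose c := NESubset ne.
have w1 : within (chains D1) (simage (mono_comp (image_mono x) t)).
  exact: image_within.
rewrite (psiE _ _ w1) /=.
rewrite (@phi_transpose phi _ _ h1 c (simage_chain x) h1 _ _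
  (mono_comp (image_mono x) t)) //.
  apply: transpose_indep; last exact: le_top.
  by rewrite mono_compE nesubset_leE image_monoE; apply: imsetS; apply/subsetP.
by move=> i; rewrite mono_compE image_monoE.
Qed.

End Transfer.

(* [h] is a discrete distance to [Q1], and [r] retracts the collar of points of
   [Q2] at distance at most K/2 onto [Q1], sending comparable points to
   comparable points. *)
Definition collar d (P : finPOrderType d) (K : nat) (Q1 Q2 : {set P}) : Prop :=
  exists (h : P -> nat) (r : P -> P),
  [/\ {in Q1, forall x, h x = 0 /\ r x = x},
      {in Q2 &, forall x y, (x >=< y)%O -> h x <= (h y).+1},
      {in Q2, forall x, (h x).*2 <= K -> r x \in Q1} &
      {in Q2 &, forall x y, (h x).*2 <= K -> (h y).*2 <= K ->
        (x >=< y)%O -> (r x >=< r y)%O}].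

(** * Collars under subdivision *)

Section Collar.
Variables (d : Order.disp_t) (P : finPOrderType d).

Definition hmin (h : P -> nat) (A : nesubset P) : nat :=
  h [arg min_(x < xchoose (set0Pn _ (nes_neq0 A)) in nes_set A) h x].

Definition hmax (h : P -> nat) (A : nesubset P) : nat :=
  h [arg max_(x > xchoose (set0Pn _ (nes_neq0 A)) in nes_set A) h x].

Lemma hminP h A : (exists2 x, x \in nes_set A & hmin h A = h x) /\
  forall x, x \in nes_set A -> hmin h A <= h x.
Proof.
rewrite /hmin; case: arg_minnP => [|x xA xP]; last by split=> //; exists x.
exact: xchooseP (set0Pn _ (nes_neq0 A)).
Qed.

Lemma hmaxP h A : (exists2 x, x \in nes_set A & hmax h A = h x) /\
  forall x, x \in nes_set A -> h x <= hmax h A.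
Proof.
rewrite /hmax; case: arg_maxnP => [|x xA xP]; last by split=> //; exists x.
exact: xchooseP (set0Pn _ (nes_neq0 A)).
Qed.

(** Along a chain [h] varies by at most one, so minimum plus maximum is either twice [h] or the odd
    value halfway between two heights. *)
Lemma collar_chains K (Q1 Q2 : {set P}) :
  collar K Q1 Q2 -> collar K.*2 (chains (within Q1)) (chains (within Q2)).
Proof.
case=> h [r [hr1 hlip rQ rcomp]].
pose low (A : nesubset P) := [set x in nes_set A | (h x).*2 <= K].
(* A chain may leave the collar of [h] by one step: only its low part is retracted. *)
exists (fun A => hmin h A + hmax h A), (fun A => insubd A (r @: low A)).
pose C2 := chains (within Q2).
have inC (Q : {set P}) (A : nesubset P) : A \in chains (within Q) ->
    (forall x, x \in nes_set A -> x \in Q) /\ {in nes_set A &, forall x y, (x >=< y)%O}.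
  by rewrite inE => /andP[/subsetP ? /chainP].
have lipA A : A \in C2 -> hmax h A <= (hmin h A).+1.
  move=> /inC[AQ Ac]; have [[x xA ->] _] := hminP h A; have [[y yA ->] _] := hmaxP h A.
  by apply: hlip; rewrite ?AQ ?Ac.
(* A minimizer of [h] on [A] lies in [low A], since twice the minimum is at most the sum; hence
   [insubd] does not fall back to its default. *)
have rE A : A \in C2 -> (hmin h A + hmax h A).*2 <= K.*2 ->
    insubd A (r @: low A) = r @: low A :> {set P}.
  move=> Ach hK; apply: insubdK; rewrite unfold_in /= imset_eq0; apply/set0Pn.
  have [[x xA hx] _] := hminP h A; have [[y yA hy] hmx] := hmaxP h A.
  exists x; rewrite inE xA /=; have := hmx _ xA; lia.
have lowS (A B : nesubset P) : (A <= B)%O -> low A \subset low B.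
  move=> /subsetP AB; apply/subsetP => x; rewrite !inE => /andP[/AB -> ->] //.
split.
- move=> A /inC[AQ _].
  have [[x xA ->] _] := hminP h A; have [[y yA ->] _] := hmaxP h A.
  rewrite !(hr1 _ (AQ _ _)).1 //; split=> //; apply: val_inj => /=.
  have lowA : r @: low A = A.
    rewrite -[RHS]imset_id; have -> : low A = A.
      apply/setP => z; rewrite inE; case: (boolP (z \in _)) => //= zA.
      by rewrite (hr1 _ (AQ _ zA)).1.
    by apply: eq_in_imset => z zA; rewrite (hr1 _ (AQ _ zA)).2.
  by rewrite lowA insubdK // unfold_in /= nes_neq0.
(* Enlarging a chain lowers the minimum or raises the maximum, but not both, as the two still differ
   by at most one. *)
- have main A B : A \in C2 -> B \in C2 -> (A <= B)%O ->
      hmin h A + hmax h A <= (hmin h B + hmax h B).+1 /\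
      hmin h B + hmax h B <= (hmin h A + hmax h A).+1.
    move=> Ach Bch /subsetP AB; move: (lipA _ Ach) (lipA _ Bch).
    have [[x xA hx] Amin] := hminP h A; have [[y yA hy] Amax] := hmaxP h A.
    have [_ Bmin] := hminP h B; have [_ Bmax] := hmaxP h B.
    have := (Bmin _ (AB _ xA)); have := Bmax _ (AB _ yA).
    have := Amax _ xA; lia.
  by move=> A B Ach Bch /orP[] AB; have [] := main _ _ _ _ AB.
- move=> A Ach hK; have [AQ Ac] := inC _ _ Ach.
  rewrite inE rE //; apply/andP; split.
    apply/subsetP => _ /imsetP[x + ->]; rewrite inE => /andP[xA hx].
    by apply: rQ; rewrite ?AQ.
  apply/chainP => _ _ /imsetP[x + ->] /imsetP[y + ->].
  rewrite !inE => /andP[xA hx] /andP[yA hy].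
  by apply: rcomp; rewrite ?AQ ?Ac.
- move=> A B Ach Bch hA hB /orP[] AB; rewrite /Order.comparable !nesubset_leE !rE //.
    by rewrite imsetS ?lowS.
  by rewrite orbC imsetS ?lowS.
Qed.

End Collar.

(** * Extending maps into a path *)

Section Line.
Variable L : nat.

(* The flag complex of the path graph 0 - 1 - ... - L. *)
Definition line_simplexb m (a : {ffun 'I_m.+1 -> nat}) : bool :=
  [forall i, (a i <= L) && [forall j, a i <= (a j).+1]].

Lemma line_simplexP m (a : {ffun 'I_m.+1 -> nat}) :
  reflect (forall i, a i <= L /\ forall j, a i <= (a j).+1) (line_simplexb a).
Proof.
apply: (iffP forallP) => h i; first by have /andP[-> /forallP] := h i.
by have [-> h2] := h i; apply/forallP.
Qed.

Lemma line_act_subproof m n (f : dmap m n) (a : {a : {ffun 'I_n.+1 -> nat} | line_simplexb a}) :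
  line_simplexb [ffun i => val a (f i)].
Proof.
apply/line_simplexP => i; rewrite ffunE; have /line_simplexP h := valP a.
by split=> [|j]; rewrite ?ffunE; have [] := h (f i).
Qed.

Definition line : sset.
Proof.
exists (fun m => {a : {ffun 'I_m.+1 -> nat} | line_simplexb a})
  (fun m n f a => exist (@line_simplexb m) _ (line_act_subproof f a)).
- by move=> n a; apply/val_inj/ffunP => i; rewrite /= ffunE mono_idE.
- by move=> l m n g f a; apply/val_inj/ffunP => i; rewrite /= !ffunE mono_compE.
Defined.

End Line.

Definition line_val L m (a : line L m) : {ffun 'I_m.+1 -> nat} := val a.

Lemma line_val_act L m n (f : dmap m n) (a : line L n) i :
  line_val (act (line L) f a) i = line_val a (f i).
Proof. by rewrite /line_val /= ffunE. Qed.

Lemma line_val_le L m (a : line L m) i : line_val a i <= L.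
Proof. by have /line_simplexP/(_ i)[] := valP a. Qed.

Lemma line_val_adj L m (a : line L m) i j : line_val a i <= (line_val a j).+1.
Proof. by have /line_simplexP/(_ i)[] := valP a. Qed.

Section ExtendLine.
Variables (d : Order.disp_t) (P : finPOrderType d) (K : nat) (Q1 Q2 : {set P}).

Lemma within_cst (Q : {set P}) m x : x \in Q -> within Q (simage (cst x : mono 'I_m.+1 P)).
Proof. by move=> xQ; apply/withinP => i; rewrite cstE. Qed.

(** Simplices of [line] are determined by their vertices, so [phi] amounts to a vertex labelling;
    the default 0 outside [Q1] respects the bound. *)
Lemma vertex_ext (phi : phom (within Q1) (line K.+1)) : exists v : P -> nat,
  [/\ forall x, v x <= K.+1,
      {in Q1 &, forall x y, (x >=< y)%O -> v x <= (v y).+1} &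
      forall m (s : mono 'I_m.+1 P) (hs : within Q1 (simage s)) i,
        line_val (phi _ _ hs) i = v (s i)].
Proof.
pose v x := if @idP (x \in Q1) is ReflectT xQ then
  line_val (phi 0 (cst x) (within_cst _ xQ)) ord0 else 0.
have vE m (s : mono 'I_m.+1 P) (hs : within Q1 (simage s)) i :
    line_val (phi _ _ hs) i = v (s i).
  rewrite /v; case: {-}_ / idP => [xQ|]; last by case; move/withinP: hs; apply.
  rewrite (phomE phi (f := cst i) hs (within_cst 0 xQ)); last by move=> x; rewrite !cstE.
  by rewrite line_val_act cstE.
have v_le x y : x \in Q1 -> y \in Q1 -> (x <= y)%O -> v x <= (v y).+1 /\ v y <= (v x).+1.
  move=> xQ yQ xy.
  have sm (i j : 'I_2) : (i <= j)%O ->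
      ((if i == ord0 then x else y) <= (if j == ord0 then x else y))%O.
    by case: i j => [[|[|//]] ?] [[|[|//]] ?] //=; rewrite ?lexx.
  pose s := mk_mono sm.
  have hs : within Q1 (simage s) by apply/withinP => i; rewrite mk_monoE; case: ifP.
  have := vE _ _ hs ord0; have := vE _ _ hs ord_max; rewrite !mk_monoE /= => <- <-.
  by split; apply: line_val_adj.
exists v; split=> //.
  by move=> x; rewrite /v; case: {-}_ / idP => // xQ; apply: line_val_le.
by move=> x y xQ yQ /orP[] xy; have [] := v_le _ _ _ _ xy.
Qed.

(* The height pushes values towards the middle of the path, so that at distance
   K/2 from [Q1] only the middle remains and no retraction is needed beyond. *)
Lemma extends_line : collar K Q1 Q2 -> extends (within Q1) (within Q2) (line K.+1).
Proof.
case=> h [r [hr1 hlip rQ rcomp]] phi.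
have [v [v_le v_adj vE]] := vertex_ext phi.
pose g x := if (h x).*2 <= K then maxn (h x) (minn (v (r x)) (K.+1 - h x)) else K.+1./2.
have gP m (s : mono 'I_m.+1 P) : within Q2 (simage s) -> line_simplexb K.+1 [ffun i => g (s i)].
  move=> /withinP hs; apply/line_simplexP => i; rewrite ffunE; split.
    by rewrite /g; case: ifP => hi; have := v_le (r (s i)); lia.
  move=> j; rewrite ffunE.
  have ij : (s i >=< s j)%O.
    by case/orP: (le_total i j) => /(mono_le s) ij; rewrite /Order.comparable ij ?orbT.
  have hij := hlip _ _ (hs i) (hs j) ij.
  have hji : h (s j) <= (h (s i)).+1 by apply: hlip; rewrite ?hs // comparable_sym.
  (* If only one of the points has 2h <= K, its height satisfies K - 1 <= 2h, so its interval
     [h, K + 1 - h] lies within 1 of the constant [K.+1./2]. *)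
  rewrite /g; case: ifP => hi; case: ifP => hj; try lia.
  have := v_adj _ _ (rQ _ (hs i) hi) (rQ _ (hs j) hj) (rcomp _ _ (hs i) (hs j) hi hj ij).
  lia.
pose g_simplex m s hs : line K.+1 m := exist (@line_simplexb K.+1 m) _ (gP m s hs).
have g_nat l m (f : dmap l m) (s : mono 'I_m.+1 P) (hs : within Q2 (simage s))
    (hsf : within Q2 (simage (mono_comp s f))) :
    g_simplex _ _ hsf = act (line K.+1) f (g_simplex _ _ hs).
  by apply/val_inj/ffunP => i; rewrite /= !ffunE mono_compE.
exists (PHom g_nat) => m s h1 h2; apply/val_inj/ffunP => i.
rewrite -[RHS]/(line_val (phi m s h1) i) vE /= ffunE /g.
have /withinP/(_ i) sQ := h1; have [-> ->] := hr1 _ sQ.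
by rewrite leq0n max0n subn0 (minn_idPl (v_le _)).
Qed.

End ExtendLine.

(** Each Ex is traded for a subdivision of the source, which doubles [K] and so leaves the length of
    the path unchanged. *)
Lemma extends_iter_Ex n : forall d (P : finPOrderType d) K (Q1 Q2 : {set P}),
  collar K Q1 Q2 ->
  extends (within Q1) (within Q2) (iter n Ex (line (2 ^ n * K).+1)).
Proof.
elim: n => [|n IH] d P K Q1 Q2 hK; first by rewrite mul1n; apply: extends_line.
apply: extends_Ex; try exact: within_down.
rewrite expnSr -mulnA mul2n; apply: IH; exact: collar_chains.
Qed.

(** * Horns and their first subdivision *)

Section HornFilling.
Variables (k : nat) (i : 'I_k.+1).

Definition in_horn_set (A : {set 'I_k.+1}) : bool := [exists j, (j != i) && (j \notin A)].

Lemma in_horn_simage m (s : dmap m k) : in_horn_set (simage s) = in_horn i s.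
Proof.
apply: eq_existsb => j; congr (_ && _); apply/idP/forallP => [h x|h].
  by apply: contraNneq h => <-; apply: simageP.
by apply/imsetP => -[x _ jx]; have := h x; rewrite -jx eqxx.
Qed.

Lemma horn_filling (X : sset) (h : hom (horn i) X) :
  extends in_horn_set predT X ->
  exists g : hom (Delta k) X, hom_comp g (horn_incl i) = h.
Proof.
move=> ext.
have hP m (s : dmap m k) : in_horn_set (simage s) -> in_horn i s by rewrite in_horn_simage.
pose phi_fun m s hs : X m := h _ (exist _ s (hP m s hs)).
have phi_nat l m (f : dmap l m) (s : dmap m k) (hs : in_horn_set (simage s))
    (hsf : in_horn_set (simage (mono_comp s f))) :
    phi_fun _ _ hsf = act X f (phi_fun _ _ hs).
  by rewrite -hom_nat; congr (hom_fun _ _); apply: val_inj.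
have [psi psiE] := ext (PHom phi_nat).
pose psi_fun m (s : Delta k m) : X m := psi m (s : mono _ _) isT.
have psi_nat l m (f : dmap l m) (s : Delta k m) :
    psi_fun _ (act (Delta k) f s) = act X f (psi_fun _ s).
  exact: phom_nat.
exists (Hom psi_nat); apply: hom_ext => m [s hs] /=.
have hs' : in_horn_set (simage s) by rewrite in_horn_simage.
by rewrite /psi_fun (psiE _ _ hs') /=; congr (hom_fun _ _); apply: val_inj.
Qed.

(** The height is 0 on the subdivided horn and 1 elsewhere; as 2 > 1, the collar is the horn itself
    and the identity retracts it. *)
Lemma collar_horn : collar 1 (chains in_horn_set) (chains predT).
Proof.
exists (fun A => (A \notin chains in_horn_set) : nat), id; split=> //.
- by move=> A ->.
- by move=> A B _ _ _; case: (_ \notin _).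
- by move=> A _; case: (boolP (A \in _)).
Qed.

End HornFilling.

Lemma is_kan_iter_Ex_line n : is_kan (iter n.+1 Ex (line (2 ^ n).+1)).
Proof.
move=> k i _ h; apply: horn_filling; apply: extends_Ex => //.
  move=> A B /subsetP AB /existsP[j /andP[ji jB]]; apply/existsP; exists j.
  by rewrite ji; apply: contra jB; apply: AB.
(* The outermost Ex paid for the subdivision that makes the horn full; the other n start from K =
   1. *)
by rewrite -[(2 ^ n)%N]muln1; apply/extends_iter_Ex/collar_horn.
Qed.

(** * Composing edges in a Kan complex *)

Definition edge (X : sset) (a b : X 0) : Prop :=
  exists e : X 1, act X (cst ord0) e = a /\ act X (cst ord_max) e = b.

(* [clip 0] and [clip 1] identify the edges 01 and 12 of Delta 2 with Delta 1. *)
Lemma clip_le (b : nat) (x y : 'I_3) :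
  (x <= y)%O -> ((inord (minn 1 (x - b)) : 'I_2) <= inord (minn 1 (y - b)))%O.
Proof. by rewrite !leEord !inordK ?ltnS ?geq_minl // => xy; lia. Qed.

Definition clip (b : nat) : mono 'I_3 'I_2 := mk_mono (clip_le b).

Lemma clipE b (x : 'I_3) : (clip b x : nat) = minn 1 (x - b).
Proof. by rewrite mk_monoE inordK // ltnS geq_minl. Qed.

(** Put [e] and [f] on the inner horn of the 2-simplex, fill it, and take the edge 02. *)
Lemma kan_edge_trans (X : sset) (a b c : X 0) :
  is_kan X -> edge a b -> edge b c -> edge a c.
Proof.
move=> kanX [e [ea eb]] [f [fb fc]].
pose one : 'I_3 := inord 1.
have oneE : one = 1 :> nat by rewrite inordK.
have hornP m (s : dmap m 2) : in_horn one s ->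
    (forall x, s x != ord_max) \/ (forall x, s x != ord0).
  case/existsP=> j /andP[j1 /forallP sj].
  have : j = ord0 \/ j = ord_max.
    case: j j1 {sj} => [[|[|[|//]]] hj] j1; [left|case/eqP: j1|right]; apply: val_inj => //=.
  by case=> jE; [right|left] => x; rewrite -jE.
pose hv m (s : horn one m) : dmap m 2 := val s.
pose g_fun m (s : horn one m) : X m :=
  if [forall x, hv _ s x != ord_max] then act X (mono_comp (clip 0) (hv _ s)) e
  else act X (mono_comp (clip 1) (hv _ s)) f.
have g_nat l m (t : dmap l m) (s : horn one m) :
    g_fun l (act (horn one) t s) = act X t (g_fun m s).
  rewrite /g_fun -[hv _ (act _ _ _)]/(mono_comp (hv _ s) t).
  have comp_clip k : mono_comp (clip k) (mono_comp (hv _ s) t) =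
      mono_comp (mono_comp (clip k) (hv _ s)) t.
    by apply: mono_ext => x; rewrite !mono_compE.
  case: (boolP [forall x, hv _ s x != ord_max]) => [/forallP hs|hs].
    rewrite ifT; last by apply/forallP => x; rewrite mono_compE.
    by rewrite comp_clip act_comp.
  have {}hs : forall x, hv _ s x != ord0.
    by case: (hornP _ _ (valP s)) => // /forallP h; rewrite h in hs.
  case: ifP => [/forallP ht|_]; last by rewrite comp_clip act_comp.
  (* Restricting along [t] leads from the edge 12 to the edge 01, so the result is constant at
     vertex 1, where [e] and [f] both give [b]. *)
  have val1 x : (hv _ s (t x) : nat) = 1.
    have := hs (t x); have := ht x; rewrite mono_compE -!val_eqE /=.
    by case: (hv _ s (t x)) => [[|[|[|//]]] ?].
  transitivity (act X (cst ord0 : dmap l 0) b).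
    rewrite -eb -act_comp; congr (act X _ e); apply: mono_ext => x.
    by apply: val_inj; rewrite /= !mono_compE !clipE val1 !cstE.
  rewrite -fb -!act_comp; congr (act X _ f); apply: mono_ext => x.
  by apply: val_inj; rewrite /= !mono_compE !clipE val1 !cstE.
have [g gE] := kanX 2 one isT (Hom g_nat).
have long_le (x y : 'I_2) : (x <= y)%O -> ((inord x.*2 : 'I_3) <= inord y.*2)%O.
  by have hx := ltn_ord x; have hy := ltn_ord y; rewrite !leEord !inordK; lia.
pose long : Delta 2 1 := mk_mono long_le.
have pt (x : 'I_3) : x != one -> in_horn one (cst x : dmap 0 2).
  move=> x1; apply/existsP; have [x0|x0] := eqVneq x ord0.
    exists ord_max; rewrite -val_eqE /= oneE; apply/forallP => y.
    by rewrite cstE x0.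
  exists ord0; rewrite -val_eqE /= oneE; apply/forallP => y.
  by rewrite cstE.
have gval (x : 'I_3) (hx : in_horn one (cst x : dmap 0 2)) :
   g 0 (cst x : Delta 2 0) = g_fun 0 (exist _ (cst x) hx).
  by rewrite -[RHS]/(Hom g_nat 0 _) -gE.
have act_long (x : 'I_2) (y : 'I_3) : x.*2 = y ->
    act (Delta 2) (cst x : dmap 0 1) long = (cst y : Delta 2 0).
  move=> xy; apply: mono_ext => z; apply: val_inj.
  by rewrite /= mono_compE !cstE mk_monoE inordK xy.
have n0 : ord0 != one by rewrite -val_eqE /= oneE.
have n2 : ord_max != one by rewrite -val_eqE /= oneE.
exists (g 1 long); rewrite -!hom_nat; split.
  rewrite (@act_long _ ord0) // (gval _ (pt _ n0)) /g_fun /=.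
  rewrite ifT; last by apply/forallP => x; rewrite cstE.
  rewrite -ea; congr (act X _ e); apply: mono_ext => x; apply: val_inj.
  by rewrite /= mono_compE clipE !cstE.
rewrite (@act_long _ ord_max) // (gval _ (pt _ n2)) /g_fun /=.
rewrite ifF; last by apply/negbTE/forallPn; exists ord0; rewrite cstE eqxx.
rewrite -fc; congr (act X _ f); apply: mono_ext => x; apply: val_inj.
by rewrite /= mono_compE clipE !cstE.
Qed.

(** * Vertices and edges of iterated Ex *)

Lemma nes_max_le k (A B : nesubset 'I_k.+1) : (A <= B)%O ->
  ((inord (\max_(x in nes_set A) x) : 'I_k.+1) <=
     (inord (\max_(x in nes_set B) x) : 'I_k.+1))%O.
Proof.
have lek (C : nesubset 'I_k.+1) : \max_(x in nes_set C) x < k.+1.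
  by rewrite ltnS; apply/bigmax_leqP => x _; rewrite -ltnS.
move=> /subsetP AB; rewrite !leEord !inordK //.
by apply/bigmax_leqP => x /AB; apply: (leq_bigmax_cond (F := @nat_of_ord _)).
Qed.

Definition nes_max k : mono (nesubset 'I_k.+1) 'I_k.+1 := mk_mono (@nes_max_le k).

Lemma nes_max_in k (A : nesubset 'I_k.+1) : nes_max k A \in nes_set A.
Proof.
rewrite mk_monoE; have A0 : 0 < #|nes_set A| by rewrite card_gt0 nes_neq0.
by have [x xA ->] := eq_bigmax_cond (@nat_of_ord _) A0; rewrite inord_val.
Qed.

(** Kan's natural map from X to Ex X, adjoint to the last vertex map from the subdivided simplex to
    the simplex. *)
Definition last_vertex (X : sset) k (x : X k) : Ex X k.
Proof.
exists (fun m (s : SdDelta k m) => act X (mono_comp (nes_max k) s) x).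
move=> l m f s; rewrite -act_comp; congr (act X _ x).
by apply: mono_ext => i; rewrite /= !mono_compE.
Defined.

Lemma edge_last_vertex (X : sset) (a b : X 0) :
  edge a b -> edge (last_vertex a) (last_vertex b).
Proof.
have cst_last (i : 'I_2) (e : X 1) :
    act (Ex X) (cst i : dmap 0 1) (last_vertex e) = last_vertex (act X (cst i) e).
  apply: hom_ext => m s /=; rewrite -act_comp; congr (act X _ e).
  apply: mono_ext => j; rewrite !mono_compE cstE.
  have := nes_max_in (image_mono (cst i) ((s : mono 'I_m.+1 (nesubset 'I_1)) j)).
  by rewrite image_monoE /= => /imsetP[x _]; rewrite cstE.
by case=> e [<- <-]; exists (last_vertex e); rewrite !cst_last.
Qed.

Definition nes1 (T : finType) (x : T) : nesubset T :=
  NESubset (introT (set0Pn [set x]) (ex_intro _ x (set11 x))).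

Section Vertices.
Variable X : sset.

(** The subdivision of a point is a point, so Ex keeps the vertices; this is the identification. *)
Fixpoint base_vertex n : iter n Ex X 0 -> X 0 :=
  if n is n'.+1 then
    fun x : hom (SdDelta 0) (iter n' Ex X) =>
      base_vertex (x 0 (cst (nes1 ord0) : SdDelta 0 0))
  else id.

Fixpoint last_vertices n (x : X 0) : iter n Ex X 0 :=
  if n is n'.+1 then last_vertex (last_vertices n' x) else x.

Lemma last_verticesK n : cancel (last_vertices n) (@base_vertex n).
Proof.
elim: n => //= n IH x.
rewrite -[RHS]IH; congr base_vertex; rewrite -[RHS]act_id; congr (act _ _ _).
by apply: mono_ext => i; rewrite [LHS]ord1 [RHS]ord1.
Qed.

Lemma edge_last_vertices n a b : edge a b -> edge (last_vertices n a) (last_vertices n b).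
Proof. by move=> ab; elim: n => //= n IH; apply: edge_last_vertex. Qed.

(** The subdivided 1-simplex consists of two edges, from {0} and from {1}, meeting in {0,1}. *)
Lemma edge_Ex (Y : sset) (a b : Ex Y 0) : edge a b ->
  let vertex (x : hom (SdDelta 0) Y) := x 0 (cst (nes1 ord0) : SdDelta 0 0) in
  exists2 c, edge (vertex a) c & edge (vertex b) c.
Proof.
case=> e [<- <-] /=.
pose top : nesubset 'I_2 := NESubset (introT (set0Pn [set: 'I_2]) (ex_intro _ ord0 (in_setT _))).
have half (x : 'I_2) : edge (X := Y) 
    ((e : hom (SdDelta 1) Y) 0 (cst (nes1 x) : SdDelta 1 0))
    ((e : hom (SdDelta 1) Y) 0 (cst top : SdDelta 1 0)).
  have le_s (i j : 'I_2) : (i <= j)%O ->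
     ((if i == ord0 then nes1 x else top) <= (if j == ord0 then nes1 x else top))%O.
    have le_top A : (A <= top)%O by rewrite nesubset_leE subsetT.
    by case: i j => [[|[|//]] ?] [[|[|//]] ?].
  exists ((e : hom (SdDelta 1) Y) 1 (mk_mono le_s : SdDelta 1 1)).
  by rewrite -!hom_nat; split; congr (hom_fun _ _); apply: mono_ext => i;
    rewrite mono_compE !cstE mk_monoE.
have end_half (x : 'I_2) :
    (act (Ex Y) (cst x) e : hom (SdDelta 0) Y) 0 (cst (nes1 ord0) : SdDelta 0 0) =
    (e : hom (SdDelta 1) Y) 0 (cst (nes1 x) : SdDelta 1 0).
  rewrite /=; congr (hom_fun _ _); apply: mono_ext => i; apply: val_inj.
  by rewrite mono_compE !cstE /= image_monoE imset_set1 cstE.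
exists ((e : hom (SdDelta 1) Y) 0 (cst top : SdDelta 1 0)).
  by have := half ord0; rewrite -end_half.
by have := half ord_max; rewrite -end_half.
Qed.

End Vertices.

(** By [edge_Ex] each Ex at most doubles the distance. Both inequalities are carried along because
    the second half of the zigzag is traversed backwards. *)
Lemma edge_line_dist L n (a b : iter n Ex (line L) 0) : edge a b ->
  line_val (base_vertex a) ord0 <= line_val (base_vertex b) ord0 + 2 ^ n /\
  line_val (base_vertex b) ord0 <= line_val (base_vertex a) ord0 + 2 ^ n.
Proof.
elim: n a b => [|n IH] a b.
  case=> e [<- <-] /=; rewrite !line_val_act !cstE !addn1.
  by split; apply: line_val_adj.
case/edge_Ex => c /IH[ac ca] /IH[bc cb] /=.
rewrite expnS mul2n -addnn !addnA.
by split; [apply: (leq_trans ac) | apply: (leq_trans bc)]; rewrite leq_add2r.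
Qed.

Lemma not_kan_iter_Ex_line n : ~ is_kan (iter n Ex (line (2 ^ n).+1)).
Proof.
move=> kanX; pose L := (2 ^ n).+1.
have ptP (j : nat) : line_simplexb L ([ffun=> minn j L] : {ffun 'I_1 -> nat}).
  by apply/line_simplexP => i; rewrite ffunE; split=> [|k]; rewrite ?ffunE; lia.
pose pt j : line L 0 := exist (@line_simplexb L 0) _ (ptP j).
have segP (j k : nat) : k <= j.+1 -> j <= k.+1 -> line_simplexb L
    ([ffun i => minn (if i == ord0 then j else k) L] : {ffun 'I_2 -> nat}).
  move=> jk kj; apply/line_simplexP => i; rewrite ffunE; split=> [|i']; rewrite ?ffunE; first lia.
  by case: ifP; case: ifP => _ _; lia.
have seg j k : k <= j.+1 -> j <= k.+1 -> edge (pt j) (pt k).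
  move=> jk kj; exists (exist (@line_simplexb L 1) _ (segP _ _ jk kj)).
  by split; apply/val_inj/ffunP => i; rewrite /= !ffunE cstE.
(* The walk starts with the degenerate edge at 0 and composes unit edges by the Kan condition; at j
   = L it joins points at distance 2^n + 1. *)
have walk j : edge (last_vertices n (pt 0)) (last_vertices n (pt j)).
  elim: j => [|j IH]; first exact/edge_last_vertices/seg.
  by apply: (kan_edge_trans kanX IH); apply/edge_last_vertices/seg; lia.
have [_] := edge_line_dist (walk L).
rewrite !last_verticesK /line_val /= !ffunE minnn min0n /L; lia.
Qed.

Theorem proposition2p3 (n : nat) :
  exists X : sset, ~ is_kan (iter n Ex X) /\ is_kan (iter n.+1 Ex X).
Proof.
exists (line (2 ^ n).+1); split; first exact: not_kan_iter_Ex_line.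
exact: is_kan_iter_Ex_line.
Qed.
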